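(* Let $b,c$ and $w_1\ge w_2\ge\cdots\ge w_n>0$ be positive real numbers. Assume that $c>1$. For $k=1,\ldots,n$ define $$\lambda_k=\frac{\sum_{i=1}^kw_i}{k+\frac{b(c-1)}{c}}.$$ If $\lambda\ge\max\{w_1/c,\lambda_1,\ldots,\lambda_n\}$, then there exists a symplectic embedding $$\coprod_{i=1}^n\mathrm{int}(B(w_i))\to Z(\lambda,\lambda b,\lambda c).$$
   Context: $\mathbb{R}^4=\mathbb{C}^2$ carries the standard symplectic form. $E(a,b)=\{z\in\mathbb{C}^2\mid \frac{\pi|z_1|^2}{a}+\frac{\pi|z_2|^2}{b}\le 1\}$, $B(a)=E(a,a)$, and $Z(a)=\{z\in\mathbb{C}^2\mid \pi|z_2|^2\le a\}$. For positive reals $a,b,c$ with $c>a$, $Z(a,b,c)=Z(a)\cup E(b,c)$. $\mathrm{int}$ denotes the interior. *)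

(* Defs.v *)
From HB Require Import structures.
From mathcomp Require Import all_boot all_order all_algebra.
From mathcomp Require Import all_classical all_reals all_analysis.

Set Implicit Arguments.
Unset Strict Implicit.
Unset Printing Implicit Defensive.

Import Order.TTheory GRing.Theory Num.Theory.
Import numFieldNormedType.Exports.

Local Open Scope classical_set_scope.
Local Open Scope ring_scope.

(* C^2 is identified with R^4 through z = (x1, y1, x2, y2),
   where z1 = x1 + i y1 and z2 = x2 + i y2. *)
Notation C2 R := ('rV[R]_4).

Section Coordinates.
Context {R : realType}.
Implicit Types z u v : C2 R.

Definition x1 z : R := z ord0 (inord 0).
Definition y1 z : R := z ord0 (inord 1).
Definition x2 z : R := z ord0 (inord 2).
Definition y2 z : R := z ord0 (inord 3).

Definition normsq1 z : R := x1 z ^+ 2 + y1 z ^+ 2.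
Definition normsq2 z : R := x2 z ^+ 2 + y2 z ^+ 2.

(* dx1 /\ dy1 + dx2 /\ dy2 *)
Definition omega u v : R :=
  (x1 u * y1 v - y1 u * x1 v) + (x2 u * y2 v - y2 u * x2 v).

End Coordinates.

Section Domains.
Context {R : realType}.
Implicit Types a b c : R.

Definition ellipsoid a b : set (C2 R) :=
  [set z | pi * normsq1 z / a + pi * normsq2 z / b <= 1].

Definition eball a : set (C2 R) := ellipsoid a a.

Definition cylinder a : set (C2 R) := [set z | pi * normsq2 z <= a].

Definition Zabc a b c : set (C2 R) := cylinder a `|` ellipsoid b c.

End Domains.

Section Smooth.
Context {R : realType} {V W : normedModType R}.

(* Meant for an open set U: then 'd f x and 'D_v f x with x in U depend only on
   the restriction of f to U. *)
Fixpoint Ck_on (k : nat) (U : set V) (f : V -> W) : Prop :=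
  if k is k'.+1 then
    (forall x, U x -> differentiable f x) /\ (forall v, Ck_on k' U ('D_v f))
  else forall x, U x -> {for x, continuous f}.

Definition smooth_on (U : set V) (f : V -> W) : Prop :=
  forall k, Ck_on k U f.

Definition immersion_on (U : set V) (f : V -> W) : Prop :=
  forall x, U x -> injective ('d f x).

End Smooth.

(* The restriction of f to D is a homeomorphism onto its image f @` D: the last
   clause says that it is open as a map to f @` D with the subspace topology. *)
Definition topological_embedding {X Y : topologicalType} (D : set X)
    (f : X -> Y) : Prop :=
  [/\ {within D, continuous f},
      set_inj D f
    & forall O : set X, open O ->
        exists2 O' : set Y, open O' & f @` (D `&` O) = f @` D `&` O'].

(* {i : I & X} carries the disjoint union topology. *)
Definition coproduct {I : choiceType} {X : topologicalType} (U : I -> set X) :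
    set {_ : I & X} :=
  [set p | U (projT1 p) (projT2 p)].

Section SymplecticEmbedding.
Context {R : realType} {I : choiceType}.

(* The pullback of omega by f is omega. *)
Definition preserves_omega (U : set (C2 R)) (f : C2 R -> C2 R) : Prop :=
  forall x, U x -> forall u v, omega ('d f x u) ('d f x v) = omega u v.

(* Only the values of f on coproduct U matter; the U i are meant to be open. *)
Definition symplectic_embedding (U : I -> set (C2 R)) (Z : set (C2 R))
    (f : {_ : I & C2 R} -> C2 R) : Prop :=
  [/\ forall p, coproduct U p -> Z (f p),
      topological_embedding (coproduct U) f
    & forall i : I, let fi := fun z : C2 R => f (existT _ i z) in
        [/\ smooth_on (U i) fi, immersion_on (U i) fi
          & preserves_omega (U i) fi]].

End SymplecticEmbedding.

(* Main.v *)
Require Import Defs.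
From HB Require Import structures.
From mathcomp Require Import all_boot all_order all_algebra.
From mathcomp Require Import all_classical all_reals all_analysis.
From mathcomp Require Import ring lra.

Set Implicit Arguments.
Unset Strict Implicit.
Unset Printing Implicit Defensive.

Import Order.TTheory GRing.Theory Num.Theory.
Import numFieldNormedType.Exports.

Local Open Scope classical_set_scope.
Local Open Scope ring_scope.

(** Everything is fibred over z2. Put h = pi |z2|^2. Over a point z2 the ball
of capacity w_i is a disc of area w_i - h in the z1-plane, while the target is
the whole plane if h <= lam, and otherwise the disc of area
lam b (1 - h / (lam c)). It is therefore enough to pack, for every h, discs of
areas w_i - h (those that are positive) into these regions, smoothly in h, and
to restore symplecticity afterwards by rotating z2.

The packing at level h is explicit. An area-preserving map unrolls the open
disc of area a = w_i - h onto a rectangle of length a and width 1: a point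
(x, y) goes to (rho, theta), where rho is the area of the part of the disc to
the left of x and theta = y / R is the position of y on the vertical chord of
length R through x. The rectangles are laid end to end in decreasing order of
the w_i, so that the i-th one begins at the sum of w_l - h over l < i; this is
an affine function of h because every earlier ball is still present whenever
the i-th one is. Finally polar coordinates wind the strip of width 1 around the
origin, and send everything of abscissa less than A into the disc of area A.

The i-th image lies over abscissas below the sum S(h) of w_l - h over l <= i,
so it fits if S(h) <= lam b (1 - h / (lam c)) for lam < h < lam c. Both sides
are affine in h. At h = lam the inequality says lambda_i <= lam, and at
h = lam c it follows from w_1 <= lam c. Images of distinct balls are disjoint
since h is preserved and the intervals of abscissas do not meet.

When a depends on z2, the unrolling changes the symplectic form by
da /\ d(theta d rho / d a); rotating z2 by the angle
2 pi theta (d rho / d a) compensates this term exactly, because da = - dh.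
This is [unroll_preserves_omega]; the polar step is [polar_preserves_omega].

All maps are built from coordinates by field operations, square roots,
arctangents, sines and cosines. Such functions form a class that is stable
under directional derivatives, whence smoothness ([elementary_map_smooth]).
That the embedding is a homeomorphism onto its image follows from continuous
left inverses on disjoint open sets ([topological_embedding_coproduct]); the
only one that is not an elementary formula inverts the function
1/2 + (t + sin t cos t) / pi, which gives the fraction of the area of a disc
that lies on one side of a chord ([disc_fraction_inverse]). *)

(** * Differentials and elementary functions *)

(** The first-order expansion at z depends only on the germ of the function. *)
Lemma is_diff_ext (R : realType) (V W : normedModType R) (f df g : V -> W) (z : V) :
  is_diff z f df -> (\near z, f z = g z) -> is_diff z g df.
Proof.
move=> [fz <-] fg.
have fgz : f z = g z by exact: (nbhs_singleton fg).
have /diff_locallyP[dfc dfo] := fz.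
have gE : g \o shift z = cst (g z) + 'd f z +o_ 0 id.
  apply/eqaddoP => e e0.
  move/eqaddoP : dfo => /(_ e e0).
  rewrite -fgz.
  move: fg; rewrite (near_shift 0).
  move=> + +; apply: filterS2 => h /=; rewrite /= !subr0 => fgh.
  by rewrite !fctE /= fgh.
have dgE : 'd g z = 'd f z :> (V -> W) by exact: (diff_unique dfc gE).
split; last by [].
by apply/diff_locallyP; split; rewrite dgE.
Qed.

Section Elementary.
Context {R : realType} {m : nat}.
Local Notation V := 'rV[R]_m.
Implicit Types (U : set V) (f g : V -> R).

(** Smoothness in the sense of [smooth_on] quantifies over iterated directional
derivatives, so it follows by induction for any class of differentiable
functions that is closed under such derivatives. The last constructor is needed because a directional
derivative is given by an elementary expression only on the set U itself. *)
Inductive elementary U : (V -> R) -> Prop :=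
| elementary_coord j : elementary U (fun z => z ord0 j)
| elementary_cst c : elementary U (fun=> c)
| elementaryD f g : elementary U f -> elementary U g ->
    elementary U (fun z => f z + g z)
| elementaryM f g : elementary U f -> elementary U g ->
    elementary U (fun z => f z * g z)
| elementaryV f : (forall z, U z -> f z != 0) -> elementary U f ->
    elementary U (fun z => (f z)^-1)
| elementary_sqrt f : (forall z, U z -> 0 < f z) -> elementary U f ->
    elementary U (fun z => Num.sqrt (f z))
| elementary_atan f : elementary U f -> elementary U (fun z => atan (f z))
| elementary_sin f : elementary U f -> elementary U (fun z => sin (f z))
| elementary_cos f : elementary U f -> elementary U (fun z => cos (f z))
| elementary_ext f g : (forall z, U z -> f z = g z) ->
    elementary U f -> elementary U g.

Lemma elementaryN U f : elementary U f -> elementary U (fun z => - f z).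
Proof.
move=> fU; apply: (@elementary_ext _ (fun z => -1 * f z)).
  by move=> z _; rewrite mulN1r.
by apply: elementaryM => //; exact: elementary_cst.
Qed.

Lemma elementaryX U f n : elementary U f -> elementary U (fun z => f z ^+ n).
Proof.
move=> fU; elim: n => [|n IHn]; first exact: elementary_cst.
apply: (@elementary_ext _ (fun z => f z * f z ^+ n)).
  by move=> z _; rewrite exprS.
exact: elementaryM.
Qed.

Lemma is_diff_chain f df (g : R -> R) (g' : R) (z : V) :
  is_diff z f df -> is_derive (f z) 1 g g' ->
  is_diff z (fun z => g (f z)) (fun u => g' * df u).
Proof.
move=> fz [gz <-].
have gfz : is_diff (f z) g ( *:%R^~ (derive1 g (f z))).
  by split; [exact/derivable1_diffP | exact: deriv1E].
apply: (@is_diff_eq _ _ _ (g \o f)) => //.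
by rewrite funeqE => u /=; rewrite derive1E mulrC.
Qed.

Lemma is_diff_coord (z : V) j :
  is_diff z (fun z : V => z ord0 j : R) (fun u => u ord0 j).
Proof.
have @f : {linear 'rV[R]_m -> R}.
  by exists (fun N : 'rV[R]_m => N ord0 j); do 2![eexists]; do ?[constructor];
     rewrite ?mxE// => ? *; rewrite ?mxE//; move=> ?; rewrite !mxE.
split; first exact: differentiable_coord.
have : 'd f z = f :> (V -> R) by apply: diff_lin; exact: coord_continuous.
by [].
Qed.

(** Pointwise forms of the differentiation rules, which apply by unification to
functions written with a bound variable. *)
Lemma is_diff_funD f df g dg (z : V) : is_diff z f df -> is_diff z g dg ->
  is_diff z (fun z => f z + g z) (fun u => df u + dg u).
Proof. by move=> fz gz; exact: (is_diffD fz gz). Qed.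

Lemma is_diff_funM f df g dg (z : V) : is_diff z f df -> is_diff z g dg ->
  is_diff z (fun z => f z * g z) (fun u => f z * dg u + g z * df u).
Proof. by move=> fz gz; exact: (is_diffM fz gz). Qed.

Lemma is_diff_funN f df (z : V) : is_diff z f df ->
  is_diff z (fun z => - f z) (fun u => - df u).
Proof. by move=> fz; exact: (is_diffN fz). Qed.

Lemma is_diff_funX2 f df (z : V) : is_diff z f df ->
  is_diff z (fun z => f z ^+ 2) (fun u => 2 * f z * df u).
Proof.
move=> fz; under [X in is_diff _ X _]eq_fun do rewrite expr2.
apply: (is_diff_eq (is_diff_funM fz fz)).
by rewrite funeqE => u; ring.
Qed.

Lemma is_derive_inv (x : R) : x != 0 -> is_derive x 1 (@GRing.inv R) (- x ^- 2).
Proof.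
move=> x0; apply: is_derive_eq; first by apply: is_deriveV => //=; exact: is_derive_id.
by rewrite scaler1.
Qed.

(** The differential is elementary in the base point, for each fixed direction:
this is the closure property that drives the induction for smoothness. *)
Lemma elementary_diff U f : open U -> elementary U f ->
  exists df : V -> V -> R, (forall z, U z -> is_diff z f (df z)) /\
    (forall u, elementary U (df ^~ u)).
Proof.
move=> oU; elim=> {f}.
- move=> j; exists (fun=> fun u => u ord0 j); split=> [z _|u].
    exact: is_diff_coord.
  exact: elementary_cst.
- move=> c; exists (fun=> fun=> 0); split=> [z _|u]; last exact: elementary_cst.
  exact: is_diff_cst.
- move=> f g _ [df [fP df_elem]] _ [dg [gP dg_elem]].
  exists (fun z u => df z u + dg z u); split=> [z Uz|u].
    by apply: is_diff_funD; [exact: fP | exact: gP].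
  exact: elementaryD.
- move=> f g f_elem [df [fP df_elem]] g_elem [dg [gP dg_elem]].
  exists (fun z u => f z * dg z u + g z * df z u); split=> [z Uz|u].
    by apply: is_diff_funM; [exact: fP | exact: gP].
  by apply: elementaryD; apply: elementaryM.
- move=> f f0 f_elem [df [fP df_elem]].
  exists (fun z u => - (f z) ^- 2 * df z u); split=> [z Uz|u].
    apply: is_diff_chain; first exact: fP.
    by apply: is_derive_inv; exact: f0.
  apply: elementaryM => //; apply: elementaryN; apply: elementaryV.
    by move=> z Uz; rewrite expf_neq0// f0.
  exact: elementaryX.
- move=> f f0 f_elem [df [fP df_elem]].
  exists (fun z u => (2 * Num.sqrt (f z))^-1 * df z u); split=> [z Uz|u].
    apply: is_diff_chain; first exact: fP.
    by apply: is_derive1_sqrt; exact: f0.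
  apply: elementaryM => //; apply: elementaryV.
    by move=> z Uz; rewrite mulf_neq0// gt_eqF// sqrtr_gt0 f0.
  by apply: elementaryM; [exact: elementary_cst | exact: elementary_sqrt].
- move=> f f_elem [df [fP df_elem]].
  exists (fun z u => (1 + f z ^+ 2)^-1 * df z u); split=> [z Uz|u].
    by apply: is_diff_chain; exact: fP.
  apply: elementaryM => //; apply: elementaryV.
    by move=> z _; rewrite gt_eqF// ltr_pwDl// sqr_ge0.
  by apply: elementaryD; [exact: elementary_cst | exact: elementaryX].
- move=> f f_elem [df [fP df_elem]].
  exists (fun z u => cos (f z) * df z u); split=> [z Uz|u].
    by apply: is_diff_chain; exact: fP.
  by apply: elementaryM => //; exact: elementary_cos.
- move=> f f_elem [df [fP df_elem]].
  exists (fun z u => - sin (f z) * df z u); split=> [z Uz|u].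
    by apply: is_diff_chain; exact: fP.
  by apply: elementaryM => //; apply: elementaryN; exact: elementary_sin.
- move=> f g fg f_elem [df [fP df_elem]].
  exists df; split=> // z Uz; apply: is_diff_ext; first exact: fP.
  by apply: filterS (open_nbhs_nbhs (conj oU Uz)).
Qed.

End Elementary.

(** A row-valued map is the finite sum of its entries times the basis rows. *)
Lemma is_diff_row (R : realType) (V : normedModType R) (n : nat)
    (F dF : V -> 'rV[R]_n) (z : V) :
  (forall j, is_diff z (fun z => F z ord0 j) (fun u => dF u ord0 j)) ->
  is_diff z F dF.
Proof.
move=> FdF.
have sum_diff (s : seq 'I_n) :
    is_diff z (fun z => \sum_(j <- s) F z ord0 j *: delta_mx ord0 j : 'rV[R]_n)
      (fun u => \sum_(j <- s) dF u ord0 j *: delta_mx ord0 j).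
  elim: s => [|j s IHs].
    under [X in is_diff _ X _]eq_fun do rewrite big_nil.
    under [X in is_diff _ _ X]eq_fun do rewrite big_nil.
    exact: is_diff_cst.
  under [X in is_diff _ X _]eq_fun do rewrite big_cons.
  under [X in is_diff _ _ X]eq_fun do rewrite big_cons.
  apply: is_diffD => //.
  exact: (is_diff_comp (FdF j) (is_diff_scalel _ (delta_mx ord0 j))).
have := sum_diff (index_enum 'I_n).
under [X in is_diff _ X _]eq_fun do rewrite -row_sum_delta.
under [X in is_diff _ _ X]eq_fun do rewrite -row_sum_delta.
exact.
Qed.

Section ElementaryMaps.
Context {R : realType}.

Definition elementary_map {m n} (U : set 'rV[R]_m) (F : 'rV[R]_m -> 'rV[R]_n) :=
  forall j, elementary U (fun z => F z ord0 j).

Lemma elementary_comp m n (U : set 'rV[R]_m) (U' : set 'rV[R]_n) F g :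
  elementary_map U F -> (forall z, U z -> U' (F z)) -> elementary U' g ->
  elementary U (fun z => g (F z)).
Proof.
move=> F_elem FU; elim=> {g}.
- exact: F_elem.
- by move=> c; exact: elementary_cst.
- by move=> f g _ fF _ gF; exact: elementaryD.
- by move=> f g _ fF _ gF; exact: elementaryM.
- by move=> f f0 _ fF; apply: elementaryV => // z /FU /f0.
- by move=> f f0 _ fF; apply: elementary_sqrt => // z /FU /f0.
- by move=> f _ fF; exact: elementary_atan.
- by move=> f _ fF; exact: elementary_sin.
- by move=> f _ fF; exact: elementary_cos.
- by move=> f g fg _ fF; apply: elementary_ext fF => z /FU /fg.
Qed.

Lemma elementary_mapS m n (U U' : set 'rV[R]_m) (F : 'rV[R]_m -> 'rV[R]_n) :
  U `<=` U' -> elementary_map U' F -> elementary_map U F.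
Proof.
move=> UU' F_elem j; apply: (elementary_comp (F := id) _ UU' (F_elem j)) => l.
exact: elementary_coord.
Qed.

Lemma elementary_map_comp m n p (U : set 'rV[R]_m) (U' : set 'rV[R]_n)
    F (G : 'rV[R]_n -> 'rV[R]_p) :
  elementary_map U F -> (forall z, U z -> U' (F z)) -> elementary_map U' G ->
  elementary_map U (G \o F).
Proof. by move=> F_elem FU G_elem j; exact: elementary_comp (G_elem j). Qed.

Lemma elementary_map_diff m n (U : set 'rV[R]_m) (F : 'rV[R]_m -> 'rV[R]_n) :
  open U -> elementary_map U F ->
  exists dF : 'rV[R]_m -> 'rV[R]_m -> 'rV[R]_n,
    (forall z, U z -> is_diff z F (dF z)) /\
    (forall u, elementary_map U (dF ^~ u)).
Proof.
move=> oU F_elem.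
have /(@choice _ _ _)[df dfP] j := elementary_diff oU (F_elem j).
exists (fun z u => \row_j df j z u); split=> [z Uz|u j].
  apply: is_diff_row => j; have [/(_ z Uz) dFj _] := dfP j.
  by under [X in is_diff _ _ X]eq_fun do rewrite mxE.
have [_ /(_ u)] := dfP j; apply: elementary_ext => z _.
by rewrite mxE.
Qed.

Lemma elementary_map_smooth m n (U : set 'rV[R]_m) (F : 'rV[R]_m -> 'rV[R]_n) :
  open U -> elementary_map U F -> smooth_on U F.
Proof.
move=> oU F_elem k; elim: k F F_elem => [|k IHk] F F_elem;
  have [dF [FdF dF_elem]] := elementary_map_diff oU F_elem.
  move=> z Uz; apply: differentiable_continuous.
  by have [] := FdF z Uz.
split=> [z Uz|v]; first by have [] := FdF z Uz.
apply: IHk => j; apply: elementary_ext (dF_elem v j) => z Uz.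
by have [Fz dFz] := FdF z Uz; rewrite deriveE// dFz.
Qed.

End ElementaryMaps.

(** * Coordinates on C2 *)

Section C2Vectors.
Context {R : realType}.
Implicit Types (a b c d : R) (z u v : C2 R).

Definition C2vec a b c d : C2 R := \row_j nth 0 [:: a; b; c; d] j.

Lemma x1_C2vec a b c d : x1 (C2vec a b c d) = a.
Proof. by rewrite /x1 mxE inordK. Qed.

Lemma y1_C2vec a b c d : y1 (C2vec a b c d) = b.
Proof. by rewrite /y1 mxE inordK. Qed.

Lemma x2_C2vec a b c d : x2 (C2vec a b c d) = c.
Proof. by rewrite /x2 mxE inordK. Qed.

Lemma y2_C2vec a b c d : y2 (C2vec a b c d) = d.
Proof. by rewrite /y2 mxE inordK. Qed.

Definition C2vecE := (x1_C2vec, y1_C2vec, x2_C2vec, y2_C2vec).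

Lemma C2vec_eta z : C2vec (x1 z) (y1 z) (x2 z) (y2 z) = z.
Proof.
apply/rowP => j; rewrite mxE.
by case: j => -[|[|[|[|//]]]] j4 /=; congr (z _ _); apply/val_inj; rewrite /= inordK.
Qed.

Lemma elementary_C2vec (U : set (C2 R)) (a b c d : C2 R -> R) :
  elementary U a -> elementary U b -> elementary U c -> elementary U d ->
  elementary_map U (fun z => C2vec (a z) (b z) (c z) (d z)).
Proof.
move=> aU bU cU dU j; under eq_fun do rewrite mxE.
by case: j => -[|[|[|[|//]]]] j4.
Qed.

Lemma is_diff_C2vec z (a b c d da db dc dd : C2 R -> R) :
  is_diff z a da -> is_diff z b db -> is_diff z c dc -> is_diff z d dd ->
  is_diff z (fun z => C2vec (a z) (b z) (c z) (d z))
            (fun u => C2vec (da u) (db u) (dc u) (dd u)).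
Proof.
move=> aP bP cP dP; apply: is_diff_row => j.
under [X in is_diff _ X _]eq_fun do rewrite mxE.
under [X in is_diff _ _ X]eq_fun do rewrite mxE.
by case: j => -[|[|[|[|//]]]] j4.
Qed.

Lemma is_diff_x1 z : is_diff z x1 x1. Proof. exact: is_diff_coord. Qed.
Lemma is_diff_y1 z : is_diff z y1 y1. Proof. exact: is_diff_coord. Qed.
Lemma is_diff_x2 z : is_diff z x2 x2. Proof. exact: is_diff_coord. Qed.
Lemma is_diff_y2 z : is_diff z y2 y2. Proof. exact: is_diff_coord. Qed.

End C2Vectors.

Lemma is_diff_funC (R : realType) (V W : normedModType R) (z : V) (c : W) :
  is_diff z (fun=> c) (fun=> 0).
Proof. exact: is_diff_cst. Qed.

(** Reduces a goal about an explicit differential to an identity of real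
numbers. Instance search is bypassed so that the differentials of named
subexpressions found in the context are used, instead of being unfolded. *)
Ltac diff_rules :=
  notypeclasses refine (is_diff_eq _ _);
  [ repeat first
    [ eassumption
    | notypeclasses refine (is_diff_x1 _) | notypeclasses refine (is_diff_y1 _)
    | notypeclasses refine (is_diff_x2 _) | notypeclasses refine (is_diff_y2 _)
    | notypeclasses refine (is_diff_funC _ _)
    | notypeclasses refine (is_diff_funX2 _)
    | notypeclasses refine (is_diff_funD _ _)
    | notypeclasses refine (is_diff_funM _ _)
    | notypeclasses refine (is_diff_funN _) ]
  | let h := fresh "h" in rewrite funeqE => h /= ].

(** * Winding a strip around the origin *)

Section Polar.
Context {R : realType}.
Implicit Types z u v : C2 R.

(** The first coordinate is the area pi r^2 and the second one the angle in
turns: in these coordinates the area form of the plane is standard. *)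
Definition polar z : C2 R :=
  C2vec (Num.sqrt (x1 z / pi) * cos (2 * pi * y1 z))
        (Num.sqrt (x1 z / pi) * sin (2 * pi * y1 z)) (x2 z) (y2 z).

(** With r^2 = rho / pi one has r dr = d rho / (2 pi), and the angle is
2 pi theta, so r dr /\ d angle = d rho /\ d theta. *)
Lemma polar_preserves_omega : preserves_omega [set z | 0 < x1 z] polar.
Proof.
move=> z /= rho0 u v.
have pi0 : pi != 0 :> R by rewrite gt_eqF// pi_gt0.
have s0 : 0 < x1 z / pi by rewrite divr_gt0// pi_gt0.
set r := Num.sqrt (x1 z / pi).
have r0 : r != 0 by rewrite gt_eqF// sqrtr_gt0.
have darg : is_diff z (fun z => x1 z / pi) (fun u => x1 u / pi).
  by diff_rules; rewrite mulr0 add0r mulrC.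
have dr : is_diff z (fun z => Num.sqrt (x1 z / pi))
    (fun u => x1 u / (2 * pi * r)).
  have dsqrt := is_diff_chain darg (is_derive1_sqrt s0).
  diff_rules; rewrite -/r.
  by move: pi pi0 r r0 => p p0 r r0; field; rewrite r0 p0.
have dang : is_diff z (fun z => 2 * pi * y1 z) (fun u => 2 * pi * y1 u).
  by diff_rules; rewrite mulr0 addr0.
have dcos := is_diff_chain dang (is_derive_cos _).
have dsin := is_diff_chain dang (is_derive_sin _).
have [_ ->] := is_diff_C2vec (is_diff_funM dr dcos) (is_diff_funM dr dsin)
  (is_diff_x2 z) (is_diff_y2 z).
rewrite /omega !C2vecE -/r.
have cs1 := cos2Dsin2 (2 * pi * y1 z).
move: (cos _) (sin _) cs1 => c s cs1.
congr (_ + _).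
transitivity ((c ^+ 2 + s ^+ 2) * (x1 u * y1 v - y1 u * x1 v)).
  by move: pi pi0 r r0 {darg dr s0 dang dcos dsin} => p p0 r r0; field; rewrite r0 p0.
by rewrite cs1 mul1r.
Qed.

End Polar.

(** * Unrolling the discs of a ball *)

Section Unroll.
Context {R : realType}.
Variables (w k C : R).
Implicit Types z u v : C2 R.

(** Here w is the capacity of the ball. The parameters k and C shift the
rectangle: over z2, where the disc has area a, it begins at C + k a. *)
Definition fiber_area z : R := w - pi * normsq2 z.
Definition chord z : R := 2 * Num.sqrt (fiber_area z / pi - x1 z ^+ 2).
(** The derivative of [swept_area] with respect to the area a of the disc, at
fixed x. *)
Definition swept_rate z : R := k + 2^-1 + atan (2 * x1 z / chord z) / pi.
(** Up to the shift C + k a, the area of the part of the disc of area a to the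
left of the abscissa x: its derivative in x is the chord length. *)
Definition swept_area z : R :=
  C + x1 z * chord z / 2 + fiber_area z * swept_rate z.
Definition height z : R := y1 z / chord z.
Definition phase z : R := 2 * pi * (swept_rate z * height z).

Definition unroll z : C2 R :=
  C2vec (swept_area z) (height z)
    (cos (phase z) * x2 z - sin (phase z) * y2 z)
    (sin (phase z) * x2 z + cos (phase z) * y2 z).

Definition open_ball : set (C2 R) := [set z | pi * normsq1 z + pi * normsq2 z < w].

Lemma chord_arg_gt0 z : open_ball z -> 0 < fiber_area z / pi - x1 z ^+ 2.
Proof.
rewrite /open_ball /= /fiber_area /normsq1 => zw.
have y0 : 0 <= pi * y1 z ^+ 2 by rewrite mulr_ge0 ?pi_ge0 ?sqr_ge0.
by rewrite subr_gt0 ltr_pdivlMr ?pi_gt0//; lra.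
Qed.

Lemma chord_gt0 z : open_ball z -> 0 < chord z.
Proof. by move=> zw; rewrite mulr_gt0// sqrtr_gt0 chord_arg_gt0. Qed.

Lemma chord_sqr z : open_ball z -> chord z ^+ 2 = 4 * (fiber_area z / pi - x1 z ^+ 2).
Proof.
by move=> zw; rewrite /chord exprMn sqr_sqrtr ?ltW ?chord_arg_gt0//; ring.
Qed.

Lemma fiber_area_gt0 z : open_ball z -> 0 < fiber_area z.
Proof.
move=> /chord_arg_gt0; rewrite subr_gt0 ltr_pdivlMr ?pi_gt0//.
by apply: le_lt_trans; rewrite mulr_ge0 ?pi_ge0 ?sqr_ge0.
Qed.

Definition dfiber_area z u : R := - (2 * pi) * (x2 z * x2 u + y2 z * y2 u).

Lemma is_diff_fiber_area z : is_diff z fiber_area (dfiber_area z).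
Proof.
by rewrite /fiber_area /normsq2; diff_rules; rewrite /dfiber_area; ring.
Qed.

Definition dchord z u : R :=
  2 * (dfiber_area z u / pi - 2 * x1 z * x1 u) / chord z.

Lemma is_diff_chord z : open_ball z -> is_diff z chord (dchord z).
Proof.
move=> zw; have S0 := chord_arg_gt0 zw.
have dS : is_diff z (fun z => fiber_area z / pi - x1 z ^+ 2)
    (fun u => dfiber_area z u / pi - 2 * x1 z * x1 u).
  have dz := is_diff_fiber_area z.
  by diff_rules; rewrite mulr0 add0r (mulrC pi^-1).
have dsqrt := is_diff_chain dS (is_derive1_sqrt S0).
rewrite /chord; diff_rules; rewrite /dchord /chord.
have s0 : Num.sqrt (fiber_area z / pi - x1 z ^+ 2) != 0.
  by rewrite gt_eqF// sqrtr_gt0.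
move: (Num.sqrt _) s0 (dfiber_area z h / pi - _) => s s0 d.
by field.
Qed.

Definition dswept_rate z u : R :=
  (2 * x1 u - x1 z * dfiber_area z u / fiber_area z) / (pi * chord z).

Lemma is_diff_swept_rate z : open_ball z -> is_diff z swept_rate (dswept_rate z).
Proof.
move=> zw; have c0 := chord_gt0 zw.
have dinv := is_diff_chain (is_diff_chord zw) (is_derive_inv (lt0r_neq0 c0)).
have darg : is_diff z (fun z => 2 * x1 z / chord z)
    (fun u => 2 * (x1 u / chord z - x1 z * dchord z u / chord z ^+ 2)).
  diff_rules; move: (chord z) c0 {dinv} => c c0.
  by field; rewrite gt_eqF.
have datan := is_diff_chain darg (is_derive1_atan _).
rewrite /swept_rate; diff_rules; rewrite /dswept_rate /dchord.
have c2 := chord_sqr zw; have a0 := fiber_area_gt0 zw; have p0 := @pi_gt0 R.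
have -> : 1 + (2 * x1 z / chord z) ^+ 2 = 4 * fiber_area z / (pi * chord z ^+ 2).
  have -> : 1 + (2 * x1 z / chord z) ^+ 2 =
      (chord z ^+ 2 + 4 * x1 z ^+ 2) / chord z ^+ 2.
    by move: (chord z) c0 {c2 dinv darg datan} => c c0; field; rewrite gt_eqF.
  rewrite {1}c2; move: (chord z) c0 {c2 dinv darg datan} => c c0.
  by move: pi p0 => p p0; field; rewrite !gt_eqF.
move: c2 c0 a0 {dinv darg datan}.
move: (chord z) (fiber_area z) (dfiber_area z h) (x1 z) (x1 h) => c a da x dx.
move: pi p0 => p p0 c2 c0 a0.
have -> : a = p * (x ^+ 2 + c ^+ 2 / 4) by rewrite c2; field; rewrite gt_eqF.
have s0 : 4 * x ^+ 2 + c ^+ 2 != 0.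
  by rewrite gt_eqF// ltr_wpDl ?exprn_gt0// mulr_ge0 ?sqr_ge0.
by field; rewrite (mulrC _ 4) s0 !gt_eqF.
Qed.

(** Writing rho = C + x R / 2 + a g, one has x dR / 2 + a dg = R dx / 2, because
a / pi = x^2 + R^2 / 4. *)
Lemma is_diff_swept_area z : open_ball z -> is_diff z swept_area
  (fun u => chord z * x1 u + swept_rate z * dfiber_area z u).
Proof.
move=> zw.
have dc := is_diff_chord zw; have dg := is_diff_swept_rate zw.
have da := is_diff_fiber_area z.
rewrite /swept_area; diff_rules; rewrite /dswept_rate /dchord.
have c2 := chord_sqr zw; have a0 := fiber_area_gt0 zw.
have c0 := chord_gt0 zw; have p0 := @pi_gt0 R.
move: c2 c0 a0 {dc dg da}.
move: (swept_rate z) (chord z) (fiber_area z) (dfiber_area z h) (x1 z) (x1 h).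
move=> g c a da x dx; move: pi p0 => p p0 c2 c0 a0.
have aE : a = p * (x ^+ 2 + c ^+ 2 / 4) by rewrite c2; field; rewrite gt_eqF.
have s0 : 4 * x ^+ 2 + c ^+ 2 != 0.
  by rewrite gt_eqF// ltr_wpDl ?exprn_gt0// mulr_ge0 ?sqr_ge0.
by rewrite aE; field; rewrite (mulrC _ 4) s0 !gt_eqF.
Qed.

Definition dheight z u : R := y1 u / chord z - y1 z * dchord z u / chord z ^+ 2.

Lemma is_diff_height z : open_ball z -> is_diff z height (dheight z).
Proof.
move=> zw; have c0 := chord_gt0 zw.
have dinv := is_diff_chain (is_diff_chord zw) (is_derive_inv (lt0r_neq0 c0)).
rewrite /height; diff_rules; rewrite /dheight.
by move: (chord z) c0 {dinv} => c c0; field; rewrite gt_eqF.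
Qed.

Definition dphase z u : R :=
  2 * pi * (swept_rate z * dheight z u + height z * dswept_rate z u).

Lemma is_diff_phase z : open_ball z -> is_diff z phase (dphase z).
Proof.
move=> zw.
have dh := is_diff_height zw; have dg := is_diff_swept_rate zw.
by rewrite /phase; diff_rules; rewrite /dphase mulr0 addr0.
Qed.

Definition dunroll z u : C2 R :=
  C2vec (chord z * x1 u + swept_rate z * dfiber_area z u) (dheight z u)
    (cos (phase z) * (x2 u - y2 z * dphase z u)
      - sin (phase z) * (y2 u + x2 z * dphase z u))
    (sin (phase z) * (x2 u - y2 z * dphase z u)
      + cos (phase z) * (y2 u + x2 z * dphase z u)).

Lemma is_diff_unroll z : open_ball z -> is_diff z unroll (dunroll z).
Proof.
move=> zw; have dp := is_diff_phase zw.
have dcos := is_diff_chain dp (is_derive_cos _).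
have dsin := is_diff_chain dp (is_derive_sin _).
apply: is_diff_C2vec; first exact: is_diff_swept_area.
- exact: is_diff_height.
- by diff_rules; ring.
- by diff_rules; ring.
Qed.

(** The two partial derivatives R and g of rho, in x and in a, satisfy
dR/da = dg/dx. With theta = y / R this gives
d rho /\ d theta = dx /\ dy + da /\ d(g theta),
and the rotation of z2 by 2 pi g theta adds dh /\ d(g theta), which is
- da /\ d(g theta). *)
Lemma unroll_preserves_omega : preserves_omega open_ball unroll.
Proof.
move=> z zw u v; have [_ ->] := is_diff_unroll zw.
rewrite /omega !C2vecE /dphase /dheight /dswept_rate /dchord /height.
have cs1 := cos2Dsin2 (phase z).
have c0 := chord_gt0 zw; have p0 := @pi_gt0 R; have a0 := fiber_area_gt0 zw.
move: cs1; rewrite /dfiber_area.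
move: (cos _) (sin _) => cs sn cs1.
(* the area form on the z2-plane is invariant under the rotation by the phase *)
have rot (X Y X' Y' : R) : (cs * X - sn * Y) * (sn * X' + cs * Y')
   - (sn * X + cs * Y) * (cs * X' - sn * Y') = X * Y' - Y * X'.
  rewrite -[RHS]mul1r -cs1; ring.
rewrite rot.
move: (chord z) (fiber_area z) (swept_rate z) c0 a0 => c a g c0 a0.
by move: pi p0 => p p0; field; rewrite !gt_eqF.
Qed.

End Unroll.

(** * The area cut off a disc by a chord *)

Section DiscFraction.
Context {R : realType}.
Implicit Types t q : R.

(** The fraction of the area of a disc of radius r that lies to the left of the
abscissa r sin t. *)
Definition disc_fraction t : R := 2^-1 + (t + sin t * cos t) / pi.

Lemma is_derive_disc_fraction t :
  is_derive t 1 disc_fraction (2 * cos t ^+ 2 / pi).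
Proof.
have -> : disc_fraction = cst 2^-1 + pi^-1 \*: (id + sin * cos).
  by rewrite funeqE => s; rewrite /disc_fraction /= !fctE /= mulrC.
have dK := is_deriveD (is_derive_cst (2^-1 : R) t (1 : R))
  (is_deriveZ pi^-1 (is_deriveD (is_derive_id t 1)
    (is_deriveM (is_derive_sin t) (is_derive_cos t)))).
apply: (is_derive_eq dK); rewrite add0r.
have := cos2Dsin2 t; move: (sin t) (cos t) => s c cs1.
rewrite /GRing.scale /=; move: pi^-1 => p.
rewrite -{1}cs1; ring.
Qed.

Let pihalf_gt0 : 0 < pi / 2 :> R.
Proof. by rewrite divr_gt0// pi_gt0. Qed.

(** The derivative 2 cos^2 t / pi is positive between the two endpoints. *)
Lemma disc_fraction_lt :
  {in `[(- (pi / 2)), pi / 2]%R &, {homo disc_fraction : s t / s < t}}.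
Proof.
apply: gtr0_derive1_lt_cc => [t _|t t_in|].
- by have [] := is_derive_disc_fraction t.
- have [_] := is_derive_disc_fraction t; rewrite derive1E => ->.
  have c0 : 0 < cos t by apply: cos_gt0_pihalf; move: t_in; rewrite in_itv.
  by rewrite divr_gt0 ?pi_gt0// mulr_gt0// exprn_gt0.
- apply: continuous_subspaceT => t; apply/differentiable_continuous/derivable1_diffP.
  by have [] := is_derive_disc_fraction t.
Qed.

Lemma disc_fraction_pihalf : disc_fraction (pi / 2) = 1.
Proof.
rewrite /disc_fraction cos_pihalf mulr0 addr0 mulrAC divff ?mul1r -?splitr//.
  have -> : (2^-1 + 2^-1 : R) = 1 by field.
  by [].
by rewrite gt_eqF// pi_gt0.
Qed.

Lemma disc_fractionN t : disc_fraction (- t) = 1 - disc_fraction t.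
Proof.
rewrite /disc_fraction sinN cosN; have p0 := @pi_gt0 R.
by move: pi p0 (sin t) (cos t) => p p0 s c; field; rewrite gt_eqF.
Qed.

Lemma disc_fraction_gt0_lt1 t : - (pi / 2) < t < pi / 2 ->
  0 < disc_fraction t < 1.
Proof.
move=> /andP[tl tr]; rewrite -[X in _ && (_ < X)]disc_fraction_pihalf.
have {1}-> : 0 = disc_fraction (- (pi / 2)).
  by rewrite disc_fractionN disc_fraction_pihalf subrr.
by rewrite !disc_fraction_lt// in_itv/= ?lexx ?(ltW tl) ?(ltW tr)//=;
  rewrite ge0_cp ?ltW.
Qed.

(** Strict monotonicity gives injectivity, and the intermediate value theorem
identifies the image with the open interval from 0 to 1, so that the domain of
continuity of the inverse is an explicit open set. *)
Lemma disc_fraction_inverse : exists inv : R -> R,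
  (forall t, - (pi / 2) < t < pi / 2 -> inv (disc_fraction t) = t) /\
  (forall q, 0 < q < 1 -> {for q, continuous inv}).
Proof.
pose I : set R := [set` `](- (pi / 2)), (pi / 2)[%R].
have K_inj : {in I &, injective disc_fraction}.
  move=> s t /set_mem/= sI /set_mem/= tI Kst.
  have sub (r : R) : I r -> r \in `[(- (pi / 2)), pi / 2]%R.
    exact: subset_itv_oo_cc.
  case: (ltgtP s t) => // st.
    by have := disc_fraction_lt (sub _ sI) (sub _ tI) st; rewrite Kst ltxx.
  by have := disc_fraction_lt (sub _ tI) (sub _ sI) st; rewrite Kst ltxx.
exists ('pinv_(fun=> 0) I disc_fraction); set inv := 'pinv_ _ _ _.
have invK t : - (pi / 2) < t < pi / 2 -> inv (disc_fraction t) = t.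
  by move=> tI; apply: pinvKV => //; rewrite inE /I /= in_itv.
split=> // q /andP[q0 q1].
have Kcont : continuous disc_fraction.
  move=> t; apply/differentiable_continuous/derivable1_diffP.
  by have [] := is_derive_disc_fraction t.
have [t tI Kt] : exists2 t, t \in `[(- (pi / 2)), pi / 2]%R & disc_fraction t = q.
  apply: IVT; first by rewrite ge0_cp ?ltW.
    exact: continuous_subspaceT.
  rewrite disc_fractionN disc_fraction_pihalf subrr.
  by rewrite ge_min ltW// le_max (ltW q1) orbT.
have {}tI : t \in `](- (pi / 2)), (pi / 2)[%R.
  move: tI; rewrite !in_itv/= => /andP[tl tr]; rewrite !lt_neqAle tl tr !andbT.
  apply/andP; split; apply/eqP => tE.
    by move: q0; rewrite -Kt -tE disc_fractionN disc_fraction_pihalf subrr ltxx.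
  by move: q1; rewrite -Kt tE disc_fraction_pihalf ltxx.
rewrite -Kt; apply: nbhs_singleton (near_can_continuous _ _).
  have /near_in_itvoo := tI; apply: filterS => s sI.
  by apply: invK; move: sI; rewrite in_itv.
by near=> s; exact: Kcont.
Unshelve. all: by end_near. Qed.

End DiscFraction.

(** * Continuity and open sets *)

Section Continuity.
Context {R : realType}.

Lemma continuous_row (T : topologicalType) n (F : T -> 'rV[R]_n) (z : T) :
  (forall j, {for z, continuous (fun z => F z ord0 j)}) -> {for z, continuous F}.
Proof.
move=> Fz; apply/cvg_ballP => e e0.
have near_j j : \forall t \near z, ball (F z ord0 j) e (F t ord0 j).
  by have /cvg_ballP/(_ e e0) := Fz j.
have near_all : \forall t \near z, forall j, ball (F z ord0 j) e (F t ord0 j).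
  exact: filter_forall.
apply: filterS near_all => t tj; split=> // i j.
by rewrite (ord1 i).
Qed.

Lemma elementary_continuous m (U : set 'rV[R]_m) f : open U -> elementary U f ->
  forall z, U z -> {for z, continuous f}.
Proof.
move=> oU f_elem z Uz; have [df [/(_ z Uz)[fz _] _]] := elementary_diff oU f_elem.
exact: differentiable_continuous.
Qed.

Lemma elementary_map_continuous m n (U : set 'rV[R]_m) (F : 'rV[R]_m -> 'rV[R]_n) :
  open U -> elementary_map U F -> forall z, U z -> {for z, continuous F}.
Proof.
move=> oU F_elem z Uz; have [dF [/(_ z Uz)[Fz _] _]] := elementary_map_diff oU F_elem.
exact: differentiable_continuous.
Qed.

Lemma open_lt_fun (T : topologicalType) (f g : T -> R) :
  continuous f -> continuous g -> open [set z | f z < g z].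
Proof.
move=> fc gc; have -> : [set z | f z < g z] = (g \- f) @^-1` [set x | 0 < x].
  by apply/seteqP; split=> z /=; rewrite subr_gt0.
apply: open_comp; last exact: open_gt.
by move=> z _; apply: continuousB; [exact: gc | exact: fc].
Qed.

Lemma open_lt_elementary m (f g : 'rV[R]_m -> R) :
  elementary setT f -> elementary setT g -> open [set z | f z < g z].
Proof.
by move=> fT gT; apply: open_lt_fun => z;
  [exact: (elementary_continuous openT fT) | exact: (elementary_continuous openT gT)].
Qed.

End Continuity.

Ltac elementary_rules := repeat first
  [ apply: elementary_coord | apply: elementary_cst | apply: elementaryN
  | apply: elementaryX | apply: elementaryD | apply: elementaryM
  | apply: elementary_atan | apply: elementary_sin | apply: elementary_cos ].

(** * Inverting the two steps *)

Section PolarInverse.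
Context {R : realType}.
Implicit Types z p : C2 R.

Lemma elementary_normsq1 (U : set (C2 R)) : elementary U normsq1.
Proof. by rewrite /normsq1; elementary_rules. Qed.

Lemma elementary_normsq2 (U : set (C2 R)) : elementary U normsq2.
Proof. by rewrite /normsq2; elementary_rules. Qed.

Lemma elementary_polar : elementary_map [set z : C2 R | 0 < x1 z] polar.
Proof.
have r_elem : elementary [set z : C2 R | 0 < x1 z] (fun z => Num.sqrt (x1 z / pi)).
  apply: elementary_sqrt; last by elementary_rules.
  by move=> z z0; rewrite divr_gt0 ?pi_gt0.
by apply: elementary_C2vec; elementary_rules.
Qed.

(** The plane minus the closed negative half-line, in z1. *)
Definition slit : set (C2 R) := [set p | 0 < Num.sqrt (normsq1 p) + x1 p].

(** The angle is recovered by the half-angle formula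
tan (phi / 2) = y / (r + x). *)
Definition polar_inv p : C2 R :=
  C2vec (pi * normsq1 p) (atan (y1 p / (Num.sqrt (normsq1 p) + x1 p)) / pi)
    (x2 p) (y2 p).

Lemma open_slit : open slit.
Proof.
apply: open_lt_fun => z; first exact: cst_continuous.
have nc : {for z, continuous normsq1}.
  exact: (elementary_continuous openT (elementary_normsq1 _)).
have xc : {for z, continuous x1}.
  exact: (elementary_continuous openT (elementary_coord _ _)).
have sc : {for z, continuous (Num.sqrt \o normsq1)}.
  by apply: continuous_comp => //; exact: sqrt_continuous.
exact: (continuousD sc xc).
Qed.

Lemma elementary_polar_inv : elementary_map slit polar_inv.
Proof.
have n_elem : elementary slit (fun p => Num.sqrt (normsq1 p)).
  apply: elementary_sqrt; last exact: elementary_normsq1.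
  move=> z; rewrite /slit /= => z0; rewrite lt_neqAle addr_ge0 ?sqr_ge0// andbT.
  apply/eqP => n0; move: z0; rewrite -n0 sqrtr0 add0r.
  move/esym/eqP : n0; rewrite paddr_eq0 ?sqr_ge0// => /andP[].
  by rewrite sqrf_eq0 => /eqP ->; rewrite ltxx.
have d_elem : elementary slit (fun p => (Num.sqrt (normsq1 p) + x1 p)^-1).
  apply: elementaryV; first by move=> z z0; rewrite gt_eqF.
  by elementary_rules.
have n1 := elementary_normsq1 slit.
by apply: elementary_C2vec; elementary_rules.
Qed.

Lemma normsq1_polar z : 0 < x1 z -> pi * normsq1 (polar z) = x1 z.
Proof.
move=> z0; rewrite /normsq1 !C2vecE !exprMn -mulrDr cos2Dsin2 mulr1 sqr_sqrtr.
  by rewrite mulrC divfK// gt_eqF// pi_gt0.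
by rewrite divr_ge0 ?pi_ge0 ?ltW.
Qed.

Lemma normsq2_polar z : normsq2 (polar z) = normsq2 z.
Proof. by rewrite /normsq2 !C2vecE. Qed.

Lemma polarK z : 0 < x1 z -> - 2^-1 < y1 z < 2^-1 ->
  slit (polar z) /\ polar_inv (polar z) = z.
Proof.
move=> z0 /andP[yl yr]; have p0 := @pi_gt0 R.
pose t := pi * y1 z.
have tI : - (pi / 2) < t < pi / 2.
  by rewrite /t -mulrN !ltr_pM2l// yl yr.
have ct0 : 0 < cos t by exact: cos_gt0_pihalf.
have r0 : 0 < Num.sqrt (x1 z / pi) by rewrite sqrtr_gt0 divr_gt0.
have rE : Num.sqrt (normsq1 (polar z)) = Num.sqrt (x1 z / pi).
  by congr Num.sqrt; rewrite -(normsq1_polar z0) mulrC mulKf// gt_eqF.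
have t2 : 2 * pi * y1 z = t *+ 2 by rewrite /t mulr2n; ring.
have dE : Num.sqrt (normsq1 (polar z)) + x1 (polar z) =
    2 * Num.sqrt (x1 z / pi) * cos t ^+ 2.
  by rewrite rE C2vecE t2 cos_mulr2n; ring.
split; first by rewrite /slit /= dE !mulr_gt0// exprn_gt0.
rewrite /polar_inv normsq1_polar// dE !C2vecE t2 sin_mulr2n.
have -> : Num.sqrt (x1 z / pi) * ((cos t * sin t) *+ 2) /
    (2 * Num.sqrt (x1 z / pi) * cos t ^+ 2) = tan t.
  rewrite /tan; move: (Num.sqrt _) r0 (cos t) ct0 => r r0 c c0.
  by field; rewrite !gt_eqF.
rewrite tanK ?in_itv//= /t mulrC mulKf ?gt_eqF//.
exact: C2vec_eta.
Qed.

End PolarInverse.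

Section UnrollInverse.
Context {R : realType}.
Variables (w k C : R).
Implicit Types z p : C2 R.

Local Notation fiber_area := (fiber_area w).
Local Notation chord := (chord w).
Local Notation unroll := (unroll w k C).
Local Notation open_ball := (open_ball w).

Lemma elementary_fiber_area (U : set (C2 R)) : elementary U fiber_area.
Proof.
by have n2 := elementary_normsq2 U; rewrite /fiber_area; elementary_rules.
Qed.

Lemma open_open_ball : open open_ball.
Proof.
have n1 := elementary_normsq1 [set: C2 R].
have n2 := elementary_normsq2 [set: C2 R].
by apply: open_lt_elementary; elementary_rules.
Qed.

Lemma elementary_unroll : elementary_map open_ball unroll.
Proof.
have a_elem := elementary_fiber_area open_ball.
have s_elem : elementary open_ball
    (fun z => Num.sqrt (fiber_area z / pi - x1 z ^+ 2)).
  by apply: elementary_sqrt; [exact: chord_arg_gt0 | elementary_rules].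
have c_elem : elementary open_ball chord by rewrite /chord; elementary_rules.
have cV_elem : elementary open_ball (fun z => (chord z)^-1).
  by apply: elementaryV => // z /chord_gt0 c0; rewrite gt_eqF.
have g_elem : elementary open_ball (swept_rate w k).
  by rewrite /swept_rate; elementary_rules.
have h_elem : elementary open_ball (height w) by rewrite /height; elementary_rules.
have p_elem : elementary open_ball (phase w k) by rewrite /phase; elementary_rules.
by apply: elementary_C2vec; rewrite /swept_area; elementary_rules.
Qed.

(** The parameter t for which x = r sin t and R = 2 r cos t, where r is the
radius of the disc. *)
Definition chord_angle z : R := atan (2 * x1 z / chord z).

Lemma cos_chord_angle_gt0 z : 0 < cos (chord_angle z).
Proof. by rewrite cos_gt0_pihalf// atan_gtNpi2 atan_ltpi2. Qed.

Lemma chord_angleE z : open_ball z ->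
  x1 z = Num.sqrt (fiber_area z / pi) * sin (chord_angle z) /\
  chord z = 2 * (Num.sqrt (fiber_area z / pi) * cos (chord_angle z)).
Proof.
move=> zw; have c0 := chord_gt0 zw; have ct0 := cos_chord_angle_gt0 z.
set s := Num.sqrt _; set t := chord_angle z.
have s2 : s ^+ 2 = fiber_area z / pi.
  by rewrite sqr_sqrtr// divr_ge0 ?pi_ge0// ltW// fiber_area_gt0.
have tanE : tan t = 2 * x1 z / chord z by exact: atanK.
have xE : x1 z = tan t * chord z / 2.
  by rewrite tanE; move: (chord z) c0 => c c0; field; rewrite gt_eqF.
have cE : chord z = 2 * (s * cos t).
  have s0 : 0 <= s by exact: sqrtr_ge0.
  apply/eqP; rewrite -(@eqrXn2 _ 2) ?(ltW c0)// ?mulr_ge0// ?(ltW ct0)//; apply/eqP.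
  have := chord_sqr zw; rewrite -s2 xE.
  have := cos2_tan2 (lt0r_neq0 ct0).
  rewrite -/t; move: (tan t) (cos t) ct0 (chord z) {tanE xE c0 s2 s0} => T c ct0 ch.
  move: s => s TE chE.
  have {}chE : ch ^+ 2 * (1 + T ^+ 2) = 4 * s ^+ 2 by rewrite mulrDr mulr1 {1}chE; field.
  rewrite -TE in chE.
  have -> : ch ^+ 2 = (ch ^+ 2 * c ^- 2) * c ^+ 2 by field; rewrite gt_eqF.
  by rewrite chE; ring.
split=> //; rewrite xE cE /tan.
by move: (cos t) (sin t) ct0 => c sn ct0; field; rewrite gt_eqF.
Qed.

Lemma swept_areaE z : open_ball z ->
  swept_area w k C z = C + fiber_area z * (k + disc_fraction (chord_angle z)).
Proof.
move=> zw; have [xE cE] := chord_angleE zw.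
have s2 : Num.sqrt (fiber_area z / pi) ^+ 2 = fiber_area z / pi.
  by rewrite sqr_sqrtr// divr_ge0 ?pi_ge0// ltW// fiber_area_gt0.
rewrite /swept_area /swept_rate /disc_fraction -/(chord_angle z).
have -> : x1 z * chord z / 2 =
    Num.sqrt (fiber_area z / pi) ^+ 2 * (sin (chord_angle z) * cos (chord_angle z)).
  by rewrite {1}xE cE; field.
rewrite s2; move: (fiber_area z) (chord_angle z) {xE cE s2} => a t.
move: (sin t * cos t) => sc; move: pi^-1 => q; ring.
Qed.

Lemma swept_area_bounds z : open_ball z ->
  C + fiber_area z * k < swept_area w k C z < C + fiber_area z * (k + 1).
Proof.
move=> zw; have a0 := fiber_area_gt0 zw; rewrite swept_areaE//.
have /andP[K0 K1] : 0 < disc_fraction (chord_angle z) < 1.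
  by apply: disc_fraction_gt0_lt1; rewrite atan_gtNpi2 atan_ltpi2.
by rewrite !ltrD2l !ltr_pM2l// ltrDl K0 ltrD2l K1.
Qed.

Lemma height_bounds z : open_ball z -> - 2^-1 < height w z < 2^-1.
Proof.
move=> zw; have c0 := chord_gt0 zw.
rewrite -ltr_norml /height normrM normfV (gtr0_norm c0) ltr_pdivrMr//.
rewrite -(@ltr_pXn2r _ 2) ?nnegrE ?normr_ge0 ?mulr_ge0 ?(ltW c0)//.
rewrite real_normK ?num_real// exprMn chord_sqr//.
move: zw; rewrite /open_ball /= /normsq1 /fiber_area => zw.
have p0 := @pi_gt0 R.
have -> : (2^-1 : R) ^+ 2 * (4 * ((w - pi * normsq2 z) / pi - x1 z ^+ 2)) =
   (w - pi * normsq2 z) / pi - x1 z ^+ 2 by move: (_ - _) => q; field.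
by rewrite ltrBrDr ltr_pdivlMr//; lra.
Qed.

Lemma fiber_area_unroll z : fiber_area (unroll z) = fiber_area z.
Proof.
rewrite /fiber_area; congr (_ - _ * _); rewrite /normsq2 !C2vecE.
have := cos2Dsin2 (phase w k z).
move: (cos _) (sin _) => c s cs1.
by rewrite -[RHS]mul1r -cs1; ring.
Qed.

(** The strips that contain the rectangles of the unrolled ball. *)
Definition unrolled : set (C2 R) := [set p | 0 < fiber_area p /\
  C + fiber_area p * k < x1 p < C + fiber_area p * (k + 1)].

Lemma open_unrolled : open unrolled.
Proof.
have a_elem := elementary_fiber_area [set: C2 R].
have -> : unrolled = [set p | 0 < fiber_area p] `&`
  ([set p | C + fiber_area p * k < x1 p] `&`
   [set p | x1 p < C + fiber_area p * (k + 1)]).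
  by apply/seteqP; split=> p /=; rewrite /unrolled /=;
    [move=> [a0 /andP[]] | move=> [a0 [-> ->]]].
by do 2?apply: openI; apply: open_lt_elementary; elementary_rules.
Qed.

(** All the data but t are explicit in the image: a from z2, then t from rho and
a, then x, R and y, and finally the phase that has to be undone. The inverse is
thus an elementary map E after a map M that computes t. *)
Lemma unroll_left_inverse : exists g : C2 R -> C2 R,
  (forall z, open_ball z -> g (unroll z) = z) /\
  (forall p, unrolled p -> {for p, continuous g}).
Proof.
have [Kinv [KinvK Kinv_cont]] := @disc_fraction_inverse R.
pose r p := Num.sqrt (fiber_area p / pi).
pose ang p := 2 * pi * ((k + 2^-1 + x1 p / pi) * y1 p).
pose E p := C2vec (r p * sin (x1 p)) (y1 p * (2 * (r p * cos (x1 p))))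
  (cos (ang p) * x2 p + sin (ang p) * y2 p)
  (- sin (ang p) * x2 p + cos (ang p) * y2 p).
pose q p := (x1 p - C) / fiber_area p - k.
pose M p := C2vec (Kinv (q p)) (y1 p) (x2 p) (y2 p).
have fM p : fiber_area (M p) = fiber_area p.
  by rewrite /fiber_area /normsq2 !C2vecE.
exists (E \o M); split=> [z zw|p [a0 /andP[pl pr]]].
  have a0 := fiber_area_gt0 zw.
  have qE : q (unroll z) = disc_fraction (chord_angle z).
    rewrite /q x1_C2vec fiber_area_unroll swept_areaE//.
    move: (fiber_area z) a0 (disc_fraction _) => a a0 d.
    by field; rewrite gt_eqF.
  have [xE cE] := chord_angleE zw.
  have tI : - (pi / 2) < chord_angle z < pi / 2.
    by rewrite atan_gtNpi2 atan_ltpi2.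
  have angE : ang (M (unroll z)) = phase w k z.
    by rewrite /ang !C2vecE qE KinvK.
  rewrite /= /E angE /r fM fiber_area_unroll !C2vecE qE KinvK// -xE -cE /height.
  rewrite divfK ?gt_eqF ?chord_gt0//.
  rewrite -[RHS]C2vec_eta; have := cos2Dsin2 (phase w k z).
  move: (cos (phase w k z)) (sin (phase w k z)) => c s cs1.
  by congr C2vec; rewrite -[RHS]mul1r -cs1; ring.
have aU : open [set p | 0 < fiber_area p].
  by have a_elem := elementary_fiber_area [set: C2 R];
    apply: open_lt_elementary; elementary_rules.
have E_elem : elementary_map [set p | 0 < fiber_area p] E.
  have a_elem := elementary_fiber_area [set p | 0 < fiber_area p].
  have r_elem : elementary [set p | 0 < fiber_area p] r.
    apply: elementary_sqrt; last by elementary_rules.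
    by move=> z z0; rewrite divr_gt0 ?pi_gt0.
  by rewrite /E /ang; apply: elementary_C2vec; elementary_rules.
have M_cont : {for p, continuous M}.
  have q_elem : elementary [set p | 0 < fiber_area p] q.
    have a_elem := elementary_fiber_area [set p | 0 < fiber_area p].
    have aV : elementary [set p | 0 < fiber_area p] (fun p => (fiber_area p)^-1).
      by apply: elementaryV => // z z0; rewrite gt_eqF.
    by rewrite /q; elementary_rules.
  have q_cont : {for p, continuous q} by exact: (elementary_continuous aU q_elem).
  have q01 : 0 < q p < 1.
    rewrite /q subr_gt0 ltr_pdivlMr// ltrBlDr (ltr_pdivrMr _ _ a0).
    by apply/andP; split; lra.
  apply: continuous_row => j; under [X in {for _, continuous X}]eq_fun do rewrite mxE.
  case: j => -[|[|[|[|//]]]] j4 /=.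
  - exact: (continuous_comp q_cont (Kinv_cont _ q01)).
  - exact: (elementary_continuous openT (elementary_coord _ _)).
  - exact: (elementary_continuous openT (elementary_coord _ _)).
  - exact: (elementary_continuous openT (elementary_coord _ _)).
have E_cont : {for M p, continuous E}.
  by apply: (elementary_map_continuous aU E_elem); rewrite /= fM.
exact: (continuous_comp M_cont E_cont).
Qed.

End UnrollInverse.

(** * Embeddings of disjoint unions *)

(** Given left inverses g_i that are continuous on disjoint open sets V_i
containing the images, the image of an open set O is cut out by the union of
the open sets of p in V_i with g_i p in O. *)
Lemma topological_embedding_coproduct (I : choiceType) (X Y : topologicalType)
    (U : I -> set X) (V : I -> set Y) (f : {_ : I & X} -> Y) (g : I -> Y -> X) :
  (forall i, open (U i)) -> (forall i, open (V i)) ->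
  (forall i j p, V i p -> V j p -> i = j) ->
  (forall i z, U i z -> V i (f (existT _ i z)) /\ g i (f (existT _ i z)) = z) ->
  (forall i z, U i z -> {for z, continuous (fun z : X => f (existT _ i z))}) ->
  (forall i p, V i p -> {for p, continuous (g i)}) ->
  topological_embedding (coproduct U) f.
Proof.
move=> oU oV disjV fK f_cont g_cont.
have oD : open (coproduct U) by apply/sigT_openP => i; exact: oU.
split.
- rewrite continuous_open_subspace// => -[i z] /set_mem Uz.
  exact: (f_cont i z Uz).
- move=> [i z] [j z'] /set_mem Uz /set_mem Uz' fE.
  have [Vi gi] := fK i z Uz; have [Vj gj] := fK j z' Uz'.
  have ij : i = j by apply: disjV Vi _; rewrite fE.
  by subst j; rewrite -gi fE gj.
- move=> O oO.
  pose O' := \bigcup_i (V i `&` g i @^-1` (existT _ i @^-1` O)).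
  exists O'.
    apply: bigcup_open => i _.
    have gV : {in V i, continuous (g i)} by move=> p /set_mem; exact: g_cont.
    have /continuous_inP := gV; apply; first exact: oV.
    by have /sigT_openP := oO; apply.
  apply/seteqP; split=> [_ [[i z] [Uz Oz] <-]|_ [[[i z] Uz <-] [j _ [Vj Oj]]]].
    have [Vi gi] := fK i z Uz.
    by split; [exists (existT _ i z) | exists i => //; split=> //=; rewrite gi].
  have [Vi gi] := fK i z Uz.
  have ij := disjV _ _ _ Vi Vj; subst j.
  by exists (existT _ i z) => //; split=> //; move: Oj; rewrite /= gi.
Qed.

(** * Symplectic maps and balls *)

Section SymplecticMaps.
Context {R : realType}.

(** Nondegeneracy of omega. *)
Lemma omega_preserving_immersion (U : set (C2 R)) (F : C2 R -> C2 R) :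
  preserves_omega U F -> immersion_on U F.
Proof.
move=> F_omega z Uz u v duv.
have omega0 t : omega (u - v) t = 0.
  rewrite -(F_omega z Uz) linearB /= duv subrr.
  by rewrite /omega /x1 /y1 /x2 /y2 !mxE !mul0r !subr0 addr0.
apply/eqP; rewrite -subr_eq0; apply/eqP; rewrite -[LHS]C2vec_eta.
have := omega0 (C2vec 0 1 0 0); have := omega0 (C2vec 1 0 0 0).
have := omega0 (C2vec 0 0 0 1); have := omega0 (C2vec 0 0 1 0).
rewrite /omega !C2vecE !mulr0 !mulr1 !subr0 !sub0r !addr0 !add0r.
move=> /eqP; rewrite oppr_eq0 => /eqP -> -> /eqP; rewrite oppr_eq0 => /eqP -> ->.
by apply/rowP => j; rewrite !mxE; case: j => -[|[|[|[|]]]].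
Qed.

Lemma preserves_omega_comp (U V : set (C2 R)) (F G : C2 R -> C2 R) :
  (forall z, U z -> V (F z)) -> (forall z, U z -> differentiable F z) ->
  (forall z, V z -> differentiable G z) ->
  preserves_omega U F -> preserves_omega V G -> preserves_omega U (G \o F).
Proof.
move=> UV dF dG F_omega G_omega z Uz u v.
by rewrite diff_comp ?[LHS]G_omega ?F_omega//; [exact: UV | exact: dF | exact/dG/UV].
Qed.

(** A point of the interior stays in the closed ball when it is scaled up
slightly, which multiplies its squared norm by more than 1. *)
Lemma interior_eball (w : R) : 0 < w -> interior (eball w) `<=` open_ball w.
Proof.
move=> w0 z /= zw.
have scale_cont : {for 1, continuous (fun t : R => t *: z)}.
  exact: scalel_continuous.
have : \forall t \near (1 : R), eball w (t *: z).
  by apply: scale_cont; rewrite scale1r.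
move=> /nbhs_ballP[e /= e0 eP].
pose t := 1 + e / 2.
have t1 : 1 < t by rewrite ltrDl divr_gt0.
have /eP : ball (1 : R) e t.
  rewrite /ball /= /t opprD addrA subrr add0r normrN gtr0_norm ?divr_gt0//.
  by rewrite ltr_pdivrMr// ltr_pMr// ltr1n.
rewrite /eball /ellipsoid /= -mulrDl ler_pdivrMr// mul1r.
have n1 : normsq1 (t *: z) = t ^+ 2 * normsq1 z.
  by rewrite /normsq1 /x1 /y1 !mxE; ring.
have n2 : normsq2 (t *: z) = t ^+ 2 * normsq2 z.
  by rewrite /normsq2 /x2 /y2 !mxE; ring.
rewrite n1 n2 /open_ball /=.
have N0 : 0 <= pi * normsq1 z + pi * normsq2 z.
  by rewrite addr_ge0// mulr_ge0 ?pi_ge0// addr_ge0// sqr_ge0.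
rewrite !(mulrCA pi) -mulrDr; move: N0; rewrite le_eqVlt => /predU1P[<-//|N0].
apply: lt_le_trans; rewrite ltr_pMl//.
by rewrite expr2 (lt_trans t1)// ltr_pMl// (lt_trans ltr01).
Qed.

End SymplecticMaps.

Section BallEmbedding.
Context {R : realType}.
Variables (w k C : R).
Hypotheses (k_ge0 : 0 <= k) (C_ge0 : 0 <= C).
Implicit Types z p : C2 R.

Definition embed_ball : C2 R -> C2 R := polar \o unroll w k C.

Lemma unroll_in_polar z : open_ball w z ->
  0 < x1 (unroll w k C z) /\ - 2^-1 < y1 (unroll w k C z) < 2^-1.
Proof.
move=> zw; rewrite !C2vecE; split; last exact: height_bounds.
have /andP[] := swept_area_bounds k C zw.
have a0 := fiber_area_gt0 zw.
by move=> + _; apply: le_lt_trans; rewrite addr_ge0// mulr_ge0// ltW.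
Qed.

Lemma elementary_embed_ball : elementary_map (open_ball w) embed_ball.
Proof.
apply: (elementary_map_comp (elementary_unroll w k C) _ elementary_polar).
by move=> z /unroll_in_polar[].
Qed.

Lemma embed_ball_preserves_omega : preserves_omega (open_ball w) embed_ball.
Proof.
have [dT [dTP _]] := elementary_map_diff (@open_open_ball _ w) (elementary_unroll w k C).
have oP : open [set z : C2 R | 0 < x1 z].
  by apply: open_lt_elementary; elementary_rules.
have [dP [dPP _]] := elementary_map_diff oP elementary_polar.
apply: (preserves_omega_comp (V := [set z | 0 < x1 z])).
- by move=> z /unroll_in_polar[].
- by move=> z /dTP[].
- by move=> z /dPP[].
- exact: unroll_preserves_omega.
- exact: polar_preserves_omega.
Qed.

Lemma normsq2_embed_ball z : normsq2 (embed_ball z) = normsq2 z.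
Proof.
rewrite /embed_ball /= normsq2_polar.
have := fiber_area_unroll w k C z; rewrite /fiber_area => /addrI/oppr_inj.
by apply: mulfI; rewrite gt_eqF// pi_gt0.
Qed.

Lemma normsq1_embed_ball z : open_ball w z ->
  pi * normsq1 (embed_ball z) = swept_area w k C z.
Proof.
by move=> /unroll_in_polar[z0 _]; rewrite /embed_ball /= normsq1_polar// C2vecE.
Qed.

Definition embedded_region : set (C2 R) :=
  slit `&` polar_inv @^-1` unrolled w k C.

Lemma open_embedded_region : open embedded_region.
Proof.
have pc : {in slit, continuous (@polar_inv R)}.
  by move=> p /set_mem; exact: (elementary_map_continuous open_slit elementary_polar_inv).
have /continuous_inP := pc; apply; first exact: open_slit.
exact: open_unrolled.
Qed.

Lemma embed_ball_left_inverse : exists g : C2 R -> C2 R,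
  (forall z, open_ball w z ->
     embedded_region (embed_ball z) /\ g (embed_ball z) = z) /\
  (forall p, embedded_region p -> {for p, continuous g}).
Proof.
have [g [gK g_cont]] := unroll_left_inverse w k C.
exists (g \o polar_inv); split=> [z zw|p [ps pu]]; last first.
  have pc : {for p, continuous polar_inv}.
    exact: (elementary_map_continuous open_slit elementary_polar_inv).
  exact: (continuous_comp pc (g_cont _ pu)).
have [z0 zI] := unroll_in_polar zw; have [sP PK] := polarK z0 zI.
rewrite /embedded_region /embed_ball /= PK gK//; split=> //; split=> //.
rewrite /unrolled /= fiber_area_unroll C2vecE; split; first exact: fiber_area_gt0.
exact: swept_area_bounds.
Qed.

End BallEmbedding.

(** * Laying the rectangles end to end *)

Section Packing.
Context {R : realType} {n : nat}.
Variable w : 'I_n.+1 -> R.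
Hypothesis w_noninc : forall i j : 'I_n.+1, (i <= j)%N -> w j <= w i.
Implicit Types i j l : 'I_n.+1.

(** Chosen so that the rectangle of the ball i, which begins at
offset i + (w i - h) i, begins at the sum of w l - h over l < i. *)
Definition offset i : R := \sum_(l < n.+1 | (l < i)%N) (w l - w i).

Lemma offset_ge0 i : 0 <= offset i.
Proof. by apply: sumr_ge0 => l li; rewrite subr_ge0 w_noninc// ltnW. Qed.

Lemma sum_lt_cst i (c : R) : \sum_(l < n.+1 | (l < i)%N) c = c * i%:R.
Proof.
rewrite -(big_ord_widen _ (fun=> c)); last by rewrite ltnW.
by rewrite sumr_const card_ord mulr_natr.
Qed.

Lemma offset_lower i (h : R) :
  offset i + (w i - h) * i%:R = \sum_(l < n.+1 | (l < i)%N) (w l - h).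
Proof.
by rewrite -sum_lt_cst -big_split/=; apply: eq_bigr => l _; rewrite addrA subrK.
Qed.

Lemma sum_leS i (F : 'I_n.+1 -> R) :
  \sum_(l < n.+1 | (l <= i)%N) F l = F i + \sum_(l < n.+1 | (l < i)%N) F l.
Proof.
rewrite (bigD1 i)//=; congr (_ + _); apply: eq_bigl => l.
by rewrite ltn_neqAle andbC.
Qed.

Lemma offset_upper i (h : R) :
  offset i + (w i - h) * (i%:R + 1) = \sum_(l < n.+1 | (l <= i)%N) (w l - h).
Proof. by rewrite sum_leS -offset_lower; ring. Qed.

Lemma offset_upperE i (h : R) : offset i + (w i - h) * (i%:R + 1) =
  \sum_(l < n.+1 | (l <= i)%N) w l - (i%:R + 1) * h.
Proof.
by rewrite offset_upper sum_leS sumrB sum_lt_cst [in RHS]sum_leS; ring.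
Qed.

(** For i < j, the interval of i ends at the sum of w l - h over l <= i, and that
of j begins at the sum over l < j; the latter has more terms, all of them
nonnegative since h < w j <= w l. *)
Lemma unrolled_disjoint i j (p : C2 R) :
  unrolled (w i) i%:R (offset i) p -> unrolled (w j) j%:R (offset j) p -> i = j.
Proof.
wlog ij : i j / (i <= j)%N.
  move=> H pi pj; case: (leqP i j) => [|/ltnW] ij; first exact: H.
  by apply/esym; exact: H.
move=> [_ /andP[_ pi_lt]] [pj0 /andP[pj_gt _]].
have [//|ij'] := eqVneq i j; exfalso.
have {ij'}ij : (i < j)%N by rewrite ltn_neqAle ij andbT.
move: pi_lt pj_gt pj0; rewrite /fiber_area; set h := pi * normsq2 p.
rewrite offset_upper offset_lower subr_gt0 => pi_lt pj_gt hj.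
have := lt_trans pj_gt pi_lt; rewrite ltNge => /negP; apply.
rewrite [leRHS](bigID (fun l : 'I_n.+1 => (l <= i)%N))/=.
rewrite -[leLHS]addr0 lerD//.
  rewrite le_eqVlt; apply/orP; left; apply/eqP; apply: eq_bigl => l.
  by rewrite andbC andb_idr// => /leq_ltn_trans; apply.
apply: sumr_ge0 => l /andP[lj _].
by rewrite subr_ge0 (le_trans (ltW hj))// w_noninc// ltnW.
Qed.

End Packing.

Theorem proposition1p16 (R : realType) (n : nat) (b c : R)
    (w : 'I_n.+1 -> R) (lam : R)
    (b_gt0 : 0 < b) (c_gt0 : 0 < c)
    (w_gt0 : forall i, 0 < w i)
    (w_noninc : forall i j : 'I_n.+1, (i <= j)%N -> w j <= w i)
    (c_gt1 : 1 < c)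
    (lambda := fun k : 'I_n.+1 =>
       (\sum_(i < n.+1 | (i <= k)%N) w i) / (k.+1%:R + b * (c - 1) / c))
    (lam_ge : \big[Num.max/w ord0 / c]_(k < n.+1) lambda k <= lam) :
  exists f : {_ : 'I_n.+1 & C2 R} -> C2 R,
    symplectic_embedding (fun i => interior (eball (w i)))
      (Zabc lam (lam * b) (lam * c)) f.
Proof.
pose F i : C2 R -> C2 R := embed_ball (w i) i%:R (offset w i).
have sub_ball i : interior (eball (w i)) `<=` open_ball (w i).
  exact: interior_eball.
have C0 := offset_ge0 w_noninc.
have F_elem i : elementary_map (open_ball (w i)) (F i).
  exact: elementary_embed_ball.
have F_elem' i : elementary_map (interior (eball (w i))) (F i).
  exact: elementary_mapS (F_elem i).
have int_open i : open (interior (eball (w i))) by exact: open_interior.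
exists (fun p => F (projT1 p) (projT2 p)); split.
- move=> [i z] /= /sub_ball zw.
  have lam0 : 0 < lam.
    apply: lt_le_trans lam_ge; apply: lt_le_trans (bigmax_ge_id _ _ _ _).
    by rewrite divr_gt0.
  rewrite /Zabc /cylinder /ellipsoid /=.
  have [h_le|h_gt] := leP (pi * normsq2 (F i z)) lam; [by left|right].
  have h_lt : pi * normsq2 (F i z) < w i.
    by rewrite normsq2_embed_ball -subr_gt0; exact: fiber_area_gt0.
  have rho_lt : pi * normsq1 (F i z) <
      \sum_(l < n.+1 | (l <= i)%N) w l - (i%:R + 1) * (pi * normsq2 (F i z)).
    rewrite normsq1_embed_ball// -offset_upperE normsq2_embed_ball.
    by have /andP[] := swept_area_bounds i%:R (offset w i) zw.
  have w_le l : w l <= lam * c.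
    rewrite -ler_pdivrMr//; apply: le_trans (_ : w ord0 / c <= _).
      by rewrite ler_pM2r ?invr_gt0// w_noninc.
    by apply: le_trans lam_ge; exact: bigmax_ge_id.
  have S_le2 : \sum_(l < n.+1 | (l <= i)%N) w l <= (i%:R + 1) * (lam * c).
    apply: (@le_trans _ _ (\sum_(l < n.+1 | (l <= i)%N) (lam * c))).
      exact: ler_sum.
    by rewrite sum_leS sum_lt_cst; lra.
  have S_le1 : \sum_(l < n.+1 | (l <= i)%N) w l <=
      lam * (i%:R + 1 + b * (c - 1) / c).
    have := le_trans (le_bigmax _ lambda i) lam_ge.
    rewrite /lambda -natr1 ler_pdivrMr//.
    by rewrite addr_gt0 ?divr_gt0 ?mulr_gt0 ?subr_gt0// ltr_wpDl.
  set rho := pi * normsq1 _ in rho_lt *.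
  set h := pi * normsq2 _ in rho_lt h_gt h_lt *.
  set S := \sum_(_ < _ | _) _ in rho_lt S_le1 S_le2.
  set m := i%:R + 1 in rho_lt S_le1 S_le2.
  have h_c : h < lam * c by exact: lt_le_trans h_lt (w_le i).
  have c1 : 0 < c - 1 by rewrite subr_gt0.
  (* the affine inequality in h: the combination of its two endpoint cases,
     at h = lam with weight lam c - h and at h = lam c with weight h - lam *)
  have bound : c * (S - m * h) <= b * (lam * c - h).
    rewrite -(ler_pM2l (mulr_gt0 lam0 c1)).
    have hc : 0 <= lam * c - h by rewrite subr_ge0 ltW.
    have hl : 0 <= h - lam by rewrite subr_ge0 ltW.
    have A := ler_wpM2l hc S_le1; have B := ler_wpM2l hl S_le2.
    have -> : lam * (c - 1) * (b * (lam * c - h)) =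
      c * ((lam * c - h) * (lam * (m + b * (c - 1) / c)) +
           (h - lam) * (m * (lam * c)) - m * (lam * c - lam) * h).
      move: c c_gt0 {A B c1 h_c w_le S_le1 S_le2 lambda lam_ge c_gt1 hc hl} => c c_gt0.
      by field; rewrite gt_eqF.
    have -> : lam * (c - 1) * (c * (S - m * h)) =
      c * ((lam * c - h) * S + (h - lam) * S - m * (lam * c - lam) * h) by ring.
    by rewrite ler_pM2l// lerB// lerD.
  have cb : 0 < c * (lam * b) by rewrite !mulr_gt0.
  have -> : rho / (lam * b) + h / (lam * c) = (c * rho + b * h) / (c * (lam * b)).
    by field; rewrite !gt_eqF.
  rewrite ler_pdivrMr// mul1r.
  have := ltW rho_lt; rewrite -(ler_pM2l c_gt0) => /le_trans/(_ bound).
  by rewrite mulrBr; lra.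
- have /choice[g gP] i := embed_ball_left_inverse (w i) (ler0n R i) (C0 i).
  apply: (topological_embedding_coproduct (g := g)
    (V := fun i => embedded_region (w i) i%:R (offset w i))).
  + exact: int_open.
  + by move=> i; exact: open_embedded_region.
  + move=> i j p [_ pi] [_ pj]; exact: (unrolled_disjoint w_noninc pi pj).
  + by move=> i z /sub_ball zw; have [/(_ z zw)] := gP i.
  + by move=> i z; apply: (elementary_map_continuous (int_open i)).
  + by move=> i p; have [_] := gP i; exact.
- move=> i /=; split.
  + exact: elementary_map_smooth.
  + apply: omega_preserving_immersion => z /sub_ball; exact: embed_ball_preserves_omega.
  + move=> z /sub_ball; exact: embed_ball_preserves_omega.
Qed.
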